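(* Let $N\ge 1$ and $0<\mu\le 1$. For every $1\le p\le\infty$ and $0<\ell\le N$, the semigroup $\{S_\mu(t)\}_{t\ge 0}$ is order preserving in $M^{p,\ell}(\mathbb{R}^N)$ and in the space of Morrey measures $\mathcal{M}^{\ell}(\mathbb{R}^N)$; that is, if $u_0\in M^{p,\ell}(\mathbb{R}^N)$ or $u_0\in\mathcal{M}^\ell(\mathbb{R}^N)$ and $u_0\ge 0$, then $S_\mu(t)u_0\ge 0$ for all $t>0$.
   Context: Morrey spaces: for $1\le p<\infty$, $0\le \ell\le N$, $M^{p,\ell}(\mathbb{R}^N)$ is the space of $\phi\in L^p_{loc}(\mathbb{R}^N)$ with $\|\phi\|_{M^{p,\ell}}:=\sup_{x_0\in\mathbb{R}^N,R>0}R^{\frac{\ell-N}{p}}\|\phi\|_{L^p(B(x_0,R))}<\infty$; $M^{\infty,\ell}(\mathbb{R}^N):=L^\infty(\mathbb{R}^N)$. Morrey measures: $\mathcal{M}^\ell(\mathbb{R}^N)$ is the space of Radon measures $\nu$ with $\sup_{x_0,R>0}R^{\ell-N}|\nu|(B(x_0,R))<\infty$. Fractional heat semigroup (for $u_t+(-\Delta)^\mu u=0$): for $0<\mu\le1$, $t>0$, $S_\mu(t)u_0(x)=\int_{\mathbb{R}^N}k_\mu(t,x-y)u_0(y)\,dy$ (with $du_0(y)$ if $u_0$ is a measure), where $k_\mu(t,x)=(2\pi)^{-N}\int_{\mathbb{R}^N}e^{ix\cdot\xi-t|\xi|^{2\mu}}\,d\xi$; $S_\mu(0)=I$. *)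

(* Defs.v *)
From HB Require Import structures.
From mathcomp Require Import all_boot all_order all_algebra.
From mathcomp Require Import all_classical all_reals all_analysis.
From mathcomp Require Import measurable_realfun.
From mathcomp Require Import complex.
Set Implicit Arguments.
Unset Strict Implicit.
Unset Printing Implicit Defensive.
Import Order.TTheory GRing.Theory Num.Theory.
Import numFieldNormedType.Exports.
Local Open Scope classical_set_scope.
Local Open Scope ring_scope.
Local Open Scope complex_scope.

(** R^N is [N.-tuple R]: the library equips tuples with the product sigma-algebra
    of the Borel sets of R, i.e. the Borel sets of R^N. *)

Notation euclid R N := (N.-tuple (measurableTypeR R)).

Section euclidean_space.
Context {R : realType}.

Definition dotp {N : nat} (x y : euclid R N) : R :=
  \sum_(i < N) tnth x i * tnth y i.

Definition enorm {N : nat} (x : euclid R N) : R := Num.sqrt (dotp x x).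

Definition subt {N : nat} (x y : euclid R N) : euclid R N :=
  [tuple tnth x i - tnth y i | i < N].

Definition eball {N : nat} (x0 : euclid R N) (r : R) : set (euclid R N) :=
  [set x | enorm (subt x x0) < r].

Definition econs {N : nat} (z : measurableTypeR R * euclid R N) : euclid R N.+1 :=
  [the N.+1.-tuple (measurableTypeR R) of z.1 :: z.2].

Lemma measurable_econs (N : nat) : measurable_fun [set: _] (@econs N).
Proof. exact: measurable_cons. Qed.

End euclidean_space.

(** N-dimensional Lebesgue measure: iterated product of the Lebesgue measure of R, transported along the
    identification of R * R^N with R^(N+1). *)

Fixpoint lebesgueN (R : realType) (N : nat) {struct N} :
    set (euclid R N) -> \bar R :=
  match N return set (euclid R N) -> \bar R with
  | 0%N => dirac ([tuple] : euclid R 0)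
  | M.+1 => pushforward
      (product_measure1 (@lebesgue_measure R) (@lebesgueN R M)) (@econs R M)
  end.

Section lebesgueN_step.
Local Open Scope ereal_scope.
Context {R : realType} (N : nat).
Variable m : {sigma_finite_measure set (euclid R N) -> \bar R}.

Let P : {measure set (measurableTypeR R * euclid R N)%type -> \bar R} :=
  product_measure1 (@lebesgue_measure R) m.

Definition lebesgueN_step : set (euclid R N.+1) -> \bar R :=
  pushforward P (@econs R N).

Let mpre (A : set (euclid R N.+1)) : measurable A -> measurable (@econs R N @^-1` A).
Proof. by move=> mA; rewrite -[X in measurable X]setTI; exact: measurable_econs. Qed.

Let step0 : lebesgueN_step set0 = 0.
Proof. by rewrite /lebesgueN_step /pushforward preimage_set0 measure0. Qed.

Let step_ge0 A : 0 <= lebesgueN_step A.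
Proof. exact: (measure_ge0 P). Qed.

Let step_sigma_additive : semi_sigma_additive lebesgueN_step.
Proof.
move=> F mF tF mUF; rewrite /lebesgueN_step /pushforward preimage_bigcup.
apply: measure_semi_sigma_additive.
- by move=> n; exact: mpre.
- apply/trivIsetP => /= i j _ _ ij; rewrite -preimage_setI.
  by move/trivIsetP : tF => /(_ _ _ _ _ ij) ->//; rewrite preimage_set0.
- by rewrite -preimage_bigcup; exact: mpre.
Qed.

HB.instance Definition _ := isMeasure.Build _ _ _ lebesgueN_step
  step0 step_ge0 step_sigma_additive.

Let uncons (x : euclid R N.+1) : measurableTypeR R * euclid R N :=
  (thead x, [tuple of behead x]).

Let econsK : cancel econs uncons.
Proof. by case=> a b; rewrite /uncons /econs theadE; congr pair; apply/val_inj. Qed.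

Let measurable_uncons : measurable_fun [set: _] uncons.
Proof.
apply/measurable_fun_pair; first exact: measurable_tnth.
exact: measurable_behead.
Qed.

Let step_sigma_finite : sigma_finite setT lebesgueN_step.
Proof.
have [F TF Foo] : sigma_finite setT P.
  have /sigma_finiteP[F [TF ndF Foo]] := sigma_finiteT (@lebesgue_measure R).
  have /sigma_finiteP[G [TG ndG Goo]] := sigma_finiteT m.
  exists (fun n => F n `*` G n).
    rewrite -setXTT TF TG predeqE => -[x y]; split.
      move=> [/= [n _ Fnx] [k _ Gky]]; exists (maxn n k) => //; split.
      - by move: x Fnx; exact/subsetPset/ndF/leq_maxl.
      - by move: y Gky; exact/subsetPset/ndG/leq_maxr.
    by move=> [n _ []/= ? ?]; split; exists n.
  move=> k; have [? ?] := Foo k; have [? ?] := Goo k.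
  split; first exact: measurableX.
  rewrite /P /= product_measure1E// lte_mul_pinfty// ge0_fin_numE//.
exists (fun n => uncons @^-1` (F n)).
  by rewrite -preimage_bigcup -TF preimage_setT.
move=> n; have [mF ltF] := Foo n; split.
  by rewrite -[X in measurable X]setTI; exact: measurable_uncons.
rewrite /lebesgueN_step /pushforward -comp_preimage.
by rewrite (_ : uncons \o econs = id)//; apply/funext => z; exact: econsK.
Qed.

HB.instance Definition _ := Measure_isSigmaFinite.Build _ _ _ lebesgueN_step
  step_sigma_finite.

End lebesgueN_step.

Section lebesgueN_measure.
Local Open Scope ereal_scope.
Context {R : realType}.

Lemma lebesgueN_sigma_finite_measure (N : nat) :
  exists m : {sigma_finite_measure set (euclid R N) -> \bar R},
    @lebesgueN R N = m :> (set (euclid R N) -> \bar R).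
Proof.
elim: N => [|N [m mE]]; first by exists (dirac ([tuple] : euclid R 0)).
by exists (@lebesgueN_step R N m); rewrite /= mE.
Qed.

Variable N : nat.

Let lebesgueN0 : @lebesgueN R N set0 = 0.
Proof. by have [m ->] := lebesgueN_sigma_finite_measure N; exact: measure0. Qed.

Let lebesgueN_ge0 A : 0 <= @lebesgueN R N A.
Proof. by have [m ->] := lebesgueN_sigma_finite_measure N; exact: measure_ge0. Qed.

Let lebesgueN_sigma_additive : semi_sigma_additive (@lebesgueN R N).
Proof.
by have [m ->] := lebesgueN_sigma_finite_measure N; exact: measure_semi_sigma_additive.
Qed.

HB.instance Definition _ := isMeasure.Build _ _ _ (@lebesgueN R N)
  lebesgueN0 lebesgueN_ge0 lebesgueN_sigma_additive.

Let lebesgueN_sigma_finite : sigma_finite setT (@lebesgueN R N).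
Proof. by have [m ->] := lebesgueN_sigma_finite_measure N; exact: sigma_finiteT. Qed.

HB.instance Definition _ := Measure_isSigmaFinite.Build _ _ _ (@lebesgueN R N)
  lebesgueN_sigma_finite.

End lebesgueN_measure.
Arguments lebesgueN {R N}.

Section frac_heat_kernel.
Context {R : realType}.

Definition cexp (z : R[i]) : R[i] :=
  (expR (complex.Re z) * cos (complex.Im z)) +i* (expR (complex.Re z) * sin (complex.Im z)).

Definition Cintegral {N : nat} (f : euclid R N -> R[i]) : R[i] :=
  Rintegral lebesgueN setT (fun x => complex.Re (f x)) +i*
  Rintegral lebesgueN setT (fun x => complex.Im (f x)).

Definition frac_heat_kernelC {N : nat} (mu t : R) (x : euclid R N) : R[i] :=
  (((2 * pi) ^+ N)^-1)%:C *
  Cintegral (fun xi => cexp ((- (t * enorm xi `^ (2 * mu))) +i* dotp x xi)).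

(* The kernel is real-valued, see [frac_heat_kernelCE]. *)
Definition frac_heat_kernel {N : nat} (mu t : R) (x : euclid R N) : R :=
  complex.Re (frac_heat_kernelC mu t x).

End frac_heat_kernel.

Section frac_heat_kernel_real.
Context {R : realType}.

Let oppt {N : nat} (x : euclid R N) : euclid R N :=
  [tuple - tnth x i | i < N].

Let measurable_oppt N : measurable_fun [set: euclid R N] (@oppt N).
Proof.
apply/measurable_fun_tnthP => i.
rewrite (_ : _ \o _ = -%R \o (fun x : euclid R N => tnth x i)).
  by apply: measurableT_comp => //; exact: measurable_tnth.
by apply/funext => x /=; rewrite tnth_mktuple.
Qed.

Let lebesgueN_oppt N (A : set (euclid R N)) : measurable A ->
  lebesgueN (oppt @^-1` A) = lebesgueN A.
Proof.
elim: N A => [|N IH] A mA.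
  by congr lebesgueN; apply/funext => x; rewrite /= [oppt x]tuple0 [in RHS](tuple0 x).
have mB : measurable (@econs R N @^-1` A).
  by rewrite -[X in measurable X]setTI; exact: measurable_econs.
rewrite /= /pushforward /product_measure1.
pose g (x : measurableTypeR R) := lebesgueN (xsection (@econs R N @^-1` A) x).
have mg : measurable_fun [set: measurableTypeR R] g
  by exact: (@measurable_fun_xsection _ _ (measurableTypeR R) (euclid R N) R (@lebesgueN R N) (@econs R N @^-1` A) mB).
transitivity (\int[lebesgue_measure]_(x in setT) (g \o (-%R : _ -> measurableTypeR R)) x)%E.
  apply: eq_integral => x _ /=; rewrite /g -[RHS]IH; last first.
    exact: (measurable_xsection (- x) mB).
  congr lebesgueN; apply/seteqP; split => y; rewrite /= /xsection /= !inE /=;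
    (suff -> : oppt (econs (x, y)) = econs (- x, oppt y) by []);
    apply/eq_from_tnth => i; rewrite tnth_mktuple;
    (have [->|i0] := eqVneq i ord0; [by []|]);
    (have [j ->] : exists j, i = lift ord0 j
      by case: (unliftP ord0 i) i0 => [j -> _|->]; [exists j|rewrite eqxx]);
    by rewrite !tnthS tnth_mktuple.
rewrite -(@ge0_integral_pushforward _ _ _ _ _ (-%R : measurableTypeR R -> measurableTypeR R) _ lebesgue_measure setT g)//.
by apply: eq_measure_integral => //= B mB' _; exact: lebesgue_measureN.
Qed.

Let ge0_integral_oppt N (f : euclid R N -> \bar R) : measurable_fun setT f ->
  (forall x, 0 <= f x)%E ->
  (\int[lebesgueN]_x f (oppt x) = \int[lebesgueN]_x f x)%E.
Proof.
move=> mf f0.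
rewrite -[LHS](@ge0_integral_pushforward _ _ _ _ _ (@oppt N) (@measurable_oppt N) lebesgueN setT f)//.
apply: eq_measure_integral; first exact: measurable_oppt.
by move=> mo B mB _; exact: lebesgueN_oppt.
Qed.

Let Rintegral_odd N (f : euclid R N -> R) : measurable_fun setT f ->
  (forall x, f (oppt x) = - f x) -> Rintegral lebesgueN setT f = 0.
Proof.
move=> mf fodd; rewrite /Rintegral integralE.
have mEf : measurable_fun setT (EFin \o f) by exact/measurable_EFinP.
rewrite -(ge0_integral_oppt (measurable_funeneg mEf))//.
have -> : (\int[lebesgueN]_x (EFin \o f)^\- (oppt x) =
           \int[lebesgueN]_x (EFin \o f)^\+ x)%E.
  by apply: eq_integral => x _; rewrite funenegE funeposE /= fodd opprK.
by case: (integral _ _ _) => [r| |] //=; rewrite subrr.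
Qed.

Let measurable_dotp N (f g : euclid R N -> euclid R N) :
  measurable_fun setT f -> measurable_fun setT g ->
  measurable_fun setT (fun xi => dotp (f xi) (g xi)).
Proof.
move=> /measurable_fun_tnthP mf /measurable_fun_tnthP mg.
apply: measurable_sum => i; apply: measurable_funM; [exact: mf|exact: mg].
Qed.

Let measurable_enorm N : measurable_fun setT (@enorm R N).
Proof.
apply: (@measurableT_comp _ _ _ _ _ _ (Num.sqrt : R -> R)).
  by apply: continuous_measurable_fun; exact: sqrt_continuous.
by apply: measurable_dotp; exact: measurable_id.
Qed.

Lemma frac_heat_kernelCE (N : nat) (mu t : R) (x : euclid R N) :
  frac_heat_kernelC mu t x = (frac_heat_kernel mu t x)%:C.
Proof.
rewrite /frac_heat_kernel /frac_heat_kernelC /Cintegral /=.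
rewrite [X in _ +i* X](_ : _ = 0); last first.
  apply: Rintegral_odd.
    apply: measurable_funM.
      apply: measurableT_comp => //; apply: measurableT_comp => //.
      apply: measurable_funM => //.
      apply: (@measurableT_comp _ _ _ _ _ _ (fun r => r `^ (2 * mu))) => //.
      exact: measurable_enorm.
    apply: measurableT_comp.
      by apply: continuous_measurable_fun; exact: continuous_sin.
    by apply: measurable_dotp => //; exact: measurable_id.
  move=> xi /=.
  have -> : dotp x (oppt xi) = - dotp x xi.
    by rewrite /dotp -sumrN; apply: eq_bigr => i _; rewrite tnth_mktuple mulrN.
  have -> : enorm (oppt xi) = enorm xi.
    by rewrite /enorm /dotp; congr Num.sqrt; apply: eq_bigr => i _;
      rewrite !tnth_mktuple mulrNN.
  by rewrite sinN mulrN.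
by apply/eqP; rewrite eq_complex /= !mul0r !mulr0 !subr0 !addr0 !eqxx.
Qed.

End frac_heat_kernel_real.

Section morrey.
Context {R : realType} {N : nat}.

Definition Lp_loc (p : \bar R) (phi : euclid R N -> R) : Prop :=
  measurable_fun setT phi /\
  forall (x0 : euclid R N) (r : R), 0 < r ->
    (phi \_ (eball x0 r)) \in Lfun lebesgueN p.

Definition morrey_norm (p l : R) (phi : euclid R N -> R) : \bar R :=
  ereal_sup [set s | exists (x0 : euclid R N) (r : R), 0 < r /\
    s = ((r `^ ((l - N%:R) / p))%:E *
         'N[lebesgueN]_(p%:E)[EFin \o (phi \_ (eball x0 r))])%E].

Definition morrey_space (p : \bar R) (l : R) : set (euclid R N -> R) :=
  [set phi | match p with
             | p'%:E => Lp_loc p phi /\ (morrey_norm p' l phi < +oo)%E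
             | +oo => phi \in Lfun lebesgueN +oo
             | -oo => False
             end]%E.

(* A real Radon measure need not have finite total variation, so it is not a
   charge in general. It is represented by its Jordan decomposition: two mutually
   singular Borel measures that are finite on bounded sets. On R^N, every such
   Borel measure is regular. *)
Record radon_measure := RadonMeasure {
  radon_pos : {measure set (euclid R N) -> \bar R};
  radon_neg : {measure set (euclid R N) -> \bar R};
  radon_pos_fin : forall x0 r, (radon_pos (eball x0 r) < +oo)%E;
  radon_neg_fin : forall x0 r, (radon_neg (eball x0 r) < +oo)%E;
  radon_singular : exists D : set (euclid R N),
    [/\ measurable D, radon_pos (~` D) = 0%E & radon_neg D = 0%E] }.

(* Meaningful on bounded sets; elsewhere both terms may be infinite. *)
Definition radon_val (nu : radon_measure) (A : set (euclid R N)) : \bar R :=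
  (radon_pos nu A - radon_neg nu A)%E.

Definition radon_variation (nu : radon_measure) (A : set (euclid R N)) : \bar R :=
  (radon_pos nu A + radon_neg nu A)%E.

Definition radon_ge0 (nu : radon_measure) : Prop :=
  forall (A : set (euclid R N)) (x0 : euclid R N) (r : R),
    measurable A -> A `<=` eball x0 r -> (0 <= radon_val nu A)%E.

Definition morrey_measure (l : R) : set radon_measure :=
  [set nu | (ereal_sup [set s : \bar R | exists (x0 : euclid R N) (r : R), (0 < r)%R /\
      s = ((r `^ (l - N%:R))%R%:E * radon_variation nu (eball x0 r))%E] < +oo)%E].

End morrey.
Arguments radon_measure : clear implicits.

(** The semigroup at positive times. The integrals are extended-real: an integrand
    whose positive and negative parts both have infinite integral yields [-oo]. *)

Section frac_heat_semigroup.
Context {R : realType} {N : nat}.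

Definition frac_heat (mu t : R) (u0 : euclid R N -> R) (x : euclid R N) : \bar R :=
  (\int[lebesgueN]_y (frac_heat_kernel mu t (subt x y) * u0 y)%:E)%E.

Definition frac_heat_measure (mu t : R) (nu : radon_measure R N) (x : euclid R N)
    : \bar R :=
  ((\int[radon_pos nu]_y (frac_heat_kernel mu t (subt x y))%:E) -
   (\int[radon_neg nu]_y (frac_heat_kernel mu t (subt x y))%:E))%E.

End frac_heat_semigroup.

(* Main.v *)
Require Import Defs.
From mathcomp Require Import all_boot all_order all_algebra.
From mathcomp Require Import all_classical all_reals all_analysis.
From mathcomp Require Import measurable_realfun.
From mathcomp Require Import ring lra.
Set Implicit Arguments.
Unset Strict Implicit.
Unset Printing Implicit Defensive.
Import Order.TTheory GRing.Theory Num.Theory.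
Import numFieldNormedType.Exports.
Local Open Scope classical_set_scope.
Local Open Scope ring_scope.

(** Everything rests on the kernel being nonnegative ([frac_heat_kernel_ge0]):
    a nonnegative kernel integrated against a nonnegative function or measure
    gives a nonnegative value.

    The kernel is the Fourier transform of [exp (- t |xi|^(2 mu))], so the claim
    is that this function is positive definite. Positive definiteness is used
    here in the form of a multiplier property: [f] is a [pos_multiplier] when
    multiplication by [f] preserves the integrable functions whose cosine
    transform is nonnegative. This class contains the characters
    [cos (a . xi)], because multiplying by one averages two translates of the
    transform, and it is closed under sums, products, exponentials and uniformly
    bounded pointwise limits.

    To reach the symbol, take [f_n], a factor [r_n < 1] times the mean over the
    coordinates of [cos^2 (xi_i / n)]. It is a multiplier with values in [0, 1),
    and [N n^2 (1 - f_n)] tends to [|xi|^2] when [r_n] tends to 1 fast enough.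
    For [0 < mu <= 1] the binomial series [1 - (1 - x)^mu = sum_k c_k x^(k+1)]
    has coefficients [c_k >= 0]; this is where the restriction on [mu] enters.
    Hence [exp (- T (1 - f_n)^mu) = exp (- T) exp (T sum_k c_k f_n^(k+1))] is a
    multiplier ([pos_multiplier_expR_powR]), and so is the limit
    [exp (- t |xi|^(2 mu))] ([pos_multiplier_frac_symbol]).

    A multiplier is finally tested on the weights [prod_i exp (- e |xi_i|)],
    whose cosine transform is an explicit nonnegative function
    ([integral_expwN_cos]); letting [e] tend to 0 removes the weight
    ([pos_multiplier_Rintegral_ge0]).

    For Radon measures, nonnegativity on bounded Borel sets forces the negative
    part of the Jordan decomposition to vanish ([radon_ge0_neg0]). *)

(** * Measurability and bilinearity on R^N *)

Section euclid_measurability.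
Context {R : realType} {N : nat}.

Lemma measurable_dotp (f g : euclid R N -> euclid R N) :
  measurable_fun setT f -> measurable_fun setT g ->
  measurable_fun setT (fun xi => dotp (f xi) (g xi)).
Proof.
move=> /measurable_fun_tnthP mf /measurable_fun_tnthP mg.
by apply: measurable_sum => i; apply: measurable_funM; [exact: mf|exact: mg].
Qed.

Lemma measurable_cos_dotp (x : euclid R N) :
  measurable_fun setT (fun xi : euclid R N => cos (dotp x xi)).
Proof.
apply: measurableT_comp.
  by apply: continuous_measurable_fun; exact: continuous_cos.
by apply: measurable_dotp.
Qed.

Lemma measurable_eball (x0 : euclid R N) (r : R) : measurable (eball x0 r).
Proof.
rewrite /eball -[X in measurable X]setTI.
rewrite (_ : [set x | _] = (fun x => enorm (subt x x0)) @^-1` `]-oo, r[%classic); last first.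
  by apply/seteqP; split => x /=; rewrite in_itv.
suff: measurable_fun setT (fun x : euclid R N => enorm (subt x x0)) by apply.
apply: (@measurableT_comp _ _ _ _ _ _ (Num.sqrt : R -> R)).
  by apply: continuous_measurable_fun; exact: sqrt_continuous.
suff ms : measurable_fun setT (fun x : euclid R N => subt x x0) by exact: measurable_dotp.
apply/measurable_fun_tnthP => i.
rewrite (_ : _ \o _ = (fun x : euclid R N => tnth x i - tnth x0 i)).
  by apply: measurable_funB => //; exact: measurable_tnth.
by apply/funext => x /=; rewrite tnth_mktuple.
Qed.

Lemma dotpDl (a b x : euclid R N) :
  dotp [tuple tnth a i + tnth b i | i < N] x = dotp a x + dotp b x.
Proof.
by rewrite -big_split /=; apply: eq_bigr => i _; rewrite tnth_mktuple mulrDl.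
Qed.

Lemma dotpBl (a b x : euclid R N) : dotp (subt a b) x = dotp a x - dotp b x.
Proof.
rewrite -sumrN -big_split /=; apply: eq_bigr => i _.
by rewrite tnth_mktuple mulrBl.
Qed.

Lemma dotp_coord (h : R) (i : 'I_N) (x : euclid R N) :
  dotp [tuple if j == i then h else 0 | j < N] x = h * tnth x i.
Proof.
rewrite /dotp (bigD1 i)//= tnth_mktuple eqxx big1 ?addr0// => j ji.
by rewrite tnth_mktuple (negbTE ji) mul0r.
Qed.

End euclid_measurability.

(** * Multipliers preserving nonnegative cosine transforms *)

Lemma integrable_bounded_mul (R : realType) d (T : measurableType d)
    (mu : {measure set T -> \bar R}) (f g : T -> R) :
  measurable_fun setT f -> (exists M, forall x, `|f x| <= M) ->
  mu.-integrable setT (EFin \o g) ->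
  mu.-integrable setT (EFin \o (fun x => f x * g x)).
Proof.
move=> mf [M fM] ig.
apply: (@integrableMr _ _ _ mu setT measurableT f (EFin \o g)) => //.
exists M; split; first exact: num_real.
by move=> r Mr x _; apply: (le_trans (fM x)); exact: ltW.
Qed.

Section positive_multipliers.
Context {R : realType} {N : nat}.
Implicit Types f g : euclid R N -> R.
Local Notation mu := (@lebesgueN R N).

Definition fourier_ge0 g := forall x : euclid R N,
  (0 <= \int[mu]_xi (g xi * cos (dotp x xi))%:E)%E.

(** An intrinsic substitute for positive definiteness: for a bounded measurable
    [f] it plays the role of being the Fourier transform of a positive measure.
    Boundedness keeps [f * g] integrable, so that multipliers can be composed. *)
Definition pos_multiplier f := [/\ measurable_fun setT f,
  exists M, forall xi, `|f xi| <= M &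
  forall g, mu.-integrable setT (EFin \o g) -> fourier_ge0 g ->
    fourier_ge0 (fun xi => f xi * g xi)].

Lemma integrable_mul_cos g (x : euclid R N) : mu.-integrable setT (EFin \o g) ->
  mu.-integrable setT (EFin \o (fun xi => g xi * cos (dotp x xi))).
Proof.
move=> ig; under eq_fun do rewrite mulrC.
apply: integrable_bounded_mul => //; first exact: measurable_cos_dotp.
by exists 1 => xi; exact: cos_max.
Qed.

Lemma pos_multiplier_cst (c : R) : 0 <= c -> pos_multiplier (fun=> c).
Proof.
move=> c0; split => //; first by exists `|c|.
move=> g ig pg x.
have -> : (\int[mu]_xi (c * g xi * cos (dotp x xi))%:E =
    \int[mu]_xi (c%:E * (g xi * cos (dotp x xi))%:E))%E.
  by apply: eq_integral => xi _; rewrite -mulrA EFinM.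
rewrite integralZl//; last exact: integrable_mul_cos.
by rewrite mule_ge0// lee_fin.
Qed.

(** By the product formula for cosines, the transform of [cos (a . xi) g] at [x]
    is the mean of the transforms of [g] at [x + a] and [x - a]. *)
Lemma pos_multiplier_cos (a : euclid R N) :
  pos_multiplier (fun xi => cos (dotp a xi)).
Proof.
split; [exact: measurable_cos_dotp|by exists 1 => xi; exact: cos_max|].
move=> g ig pg x.
pose xpa : euclid R N := [tuple tnth x i + tnth a i | i < N].
have -> : (\int[mu]_xi (cos (dotp a xi) * g xi * cos (dotp x xi))%:E =
  \int[mu]_xi (2^-1%:E * ((g xi * cos (dotp xpa xi))%:E +
     (g xi * cos (dotp (subt x a) xi))%:E)))%E.
  apply: eq_integral => xi _; rewrite -EFinD -EFinM; congr EFin.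
  by rewrite dotpDl dotpBl cosD cosB; field.
have i1 := integrable_mul_cos xpa ig.
have i2 := integrable_mul_cos (subt x a) ig.
rewrite integralZl//; last exact: integrableD.
rewrite integralD// mule_ge0//.
by apply: adde_ge0; [exact: pg xpa|exact: pg (subt x a)].
Qed.

Lemma pos_multiplierD f1 f2 : pos_multiplier f1 -> pos_multiplier f2 ->
  pos_multiplier (fun xi => f1 xi + f2 xi).
Proof.
move=> [m1 [M1 b1] p1] [m2 [M2 b2] p2]; split.
- exact: measurable_funD.
- by exists (M1 + M2) => xi; rewrite (le_trans (ler_normD _ _))// lerD.
move=> g ig pg x.
have -> : (\int[mu]_xi ((f1 xi + f2 xi) * g xi * cos (dotp x xi))%:E =
    \int[mu]_xi ((f1 xi * g xi * cos (dotp x xi))%:E +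
                 (f2 xi * g xi * cos (dotp x xi))%:E))%E.
  by apply: eq_integral => xi _; rewrite -EFinD; congr EFin; ring.
have i1 : mu.-integrable setT (EFin \o (fun xi => f1 xi * g xi * cos (dotp x xi))).
  by apply: integrable_mul_cos; apply: integrable_bounded_mul => //; exists M1.
have i2 : mu.-integrable setT (EFin \o (fun xi => f2 xi * g xi * cos (dotp x xi))).
  by apply: integrable_mul_cos; apply: integrable_bounded_mul => //; exists M2.
by rewrite integralD// adde_ge0//; [exact: p1|exact: p2].
Qed.

Lemma pos_multiplierM f1 f2 : pos_multiplier f1 -> pos_multiplier f2 ->
  pos_multiplier (fun xi => f1 xi * f2 xi).
Proof.
move=> [m1 [M1 b1] p1] [m2 [M2 b2] p2]; split.
- exact: measurable_funM.
- by exists (M1 * M2) => xi; rewrite normrM ler_pM.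
move=> g ig pg x.
under eq_integral do rewrite -[X in X * cos _]mulrA.
apply: p1; last exact: p2.
by apply: integrable_bounded_mul => //; exists M2.
Qed.

Lemma pos_multiplier_sum (I : Type) (s : seq I) (F : I -> euclid R N -> R) :
  (forall i, pos_multiplier (F i)) ->
  pos_multiplier (fun xi => \sum_(i <- s) F i xi).
Proof.
move=> pF; elim: s => [|i s IH].
  by under eq_fun do rewrite big_nil; exact: pos_multiplier_cst.
by under eq_fun do rewrite big_cons; exact: pos_multiplierD.
Qed.

Lemma pos_multiplierX f n : pos_multiplier f -> pos_multiplier (fun xi => f xi ^+ n).
Proof.
move=> pf; elim: n => [|n IH].
  by under eq_fun do rewrite expr0; exact: pos_multiplier_cst.
by under eq_fun do rewrite exprS; exact: pos_multiplierM.
Qed.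

(** Dominated convergence: against a fixed integrable [g] the uniform bound [M]
    gives the majorant [M |g|]. *)
Lemma pos_multiplier_lim (F : nat -> euclid R N -> R) f (M : R) :
  (forall n, pos_multiplier (F n)) -> (forall n xi, `|F n xi| <= M) ->
  (forall xi, F n xi @[n --> \oo] --> f xi) -> pos_multiplier f.
Proof.
move=> pF FM Ff.
have mf : measurable_fun setT f.
  apply: (@measurable_fun_cvg _ _ _ setT F) => [n|xi _]; first by have [] := pF n.
  exact: Ff.
have fM xi : `|f xi| <= M.
  have cF : `|F n xi| @[n --> \oo] --> `|f xi| by apply: cvg_norm; exact: Ff.
  rewrite -(cvg_lim _ cF)//; apply: limr_le.
    by apply/cvg_ex; eexists; exact: cF.
  by apply: nearW => n.
split => //; first by exists M.
move=> g ig pg x.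
have [] := @dominated_convergence _ _ R mu setT measurableT
  (fun n xi => (F n xi * g xi * cos (dotp x xi))%:E)
  (fun xi => (f xi * g xi * cos (dotp x xi))%:E)
  (fun xi => (M%:E * `|(g xi)%:E|)%E).
- move=> n; apply/measurable_EFinP.
  apply: measurable_funM; last exact: measurable_cos_dotp.
  apply: measurable_funM; first by have [] := pF n.
  by apply/measurable_EFinP; exact: measurable_int ig.
- apply/measurable_EFinP.
  apply: measurable_funM; last exact: measurable_cos_dotp.
  apply: measurable_funM => //.
  by apply/measurable_EFinP; exact: measurable_int ig.
- apply: aeW => xi _; apply/cvg_EFin; first exact: nearW.
  by apply: cvgMl; apply: cvgMl; exact: Ff.
- by apply: integrableZl => //; exact: integrable_abse.
- apply: aeW => xi n _ /=.
  rewrite lee_fin !normrM -mulrA ler_pM ?mulr_ge0//.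
  by rewrite -[leRHS]mulr1 ler_pM// cos_max.
move=> _ _ cI.
rewrite -(cvg_lim _ cI)//; apply: lime_ge.
  by apply/cvg_ex; eexists; exact: cI.
apply: nearW => n.
by have [_ _] := pF n; apply.
Qed.

(** The exponential series has nonnegative coefficients, and its partial sums at
    [f xi] are bounded by [expR M] as soon as [|f| <= M]. *)
Lemma pos_multiplier_expR f : pos_multiplier f ->
  pos_multiplier (fun xi => expR (f xi)).
Proof.
move=> pf; have [_ [M fM] _] := pf.
apply: (@pos_multiplier_lim (fun n xi => series (exp_coeff (f xi)) n) _ (expR M)).
- move=> n; rewrite /series /=; apply: pos_multiplier_sum => k.
  under eq_fun do rewrite /exp_coeff/= mulrC.
  apply: pos_multiplierM; last exact: pos_multiplierX.
  by apply: pos_multiplier_cst; rewrite invr_ge0.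
- move=> n xi; rewrite /series /=.
  have M0 : 0 <= M by rewrite (le_trans _ (fM xi)).
  apply: (@le_trans _ _ (series (exp_coeff M) n)).
    rewrite /series/= (le_trans (ler_norm_sum _ _ _))//; apply: ler_sum => k _.
    rewrite /exp_coeff/= normrM normrX (ger0_norm (_ : 0 <= k`!%:R^-1))//.
    by rewrite ler_wpM2r// ?invr_ge0// lerXn2r// ?nnegrE.
  apply: nondecreasing_cvgn_le; last exact: is_cvg_series_exp_coeff.
  by apply: nondecreasing_series => k _ _; exact: exp_coeff_ge0.
- by move=> xi; exact: is_cvg_series_exp_coeff.
Qed.

End positive_multipliers.

(** * The binomial series of 1 - (1 - x)^mu *)

Section binomial_series.
Context {R : realType}.
Variable mu : R.
Hypothesis hmu : 0 < mu <= 1.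

(** The absolute values of the generalized binomial coefficients of [mu]:
    [bcoef k] is [(-1)^k] times [mu] choose [k + 1]. The sign pattern
    is that of exponents in (0, 1], which makes all of them nonnegative. *)
Fixpoint bcoef (k : nat) : R :=
  if k is k'.+1 then (k'.+1%:R - mu) / k'.+2%:R * bcoef k' else mu.

Lemma bcoef_ge0 k : 0 <= bcoef k.
Proof.
elim: k => [|k IH] /=; first by case/andP: hmu => /ltW.
rewrite mulr_ge0// divr_ge0// subr_ge0.
by rewrite (le_trans (_ : mu <= 1)) ?ler1n//; case/andP: hmu.
Qed.

Lemma mul_bcoef_le k : k.+1%:R * bcoef k <= mu.
Proof.
elim: k => [|k IH] /=; first by rewrite mul1r.
rewrite mulrA mulrCA divff ?mulr1 ?pnatr_eq0//.
apply: le_trans IH; by rewrite ler_wpM2r ?bcoef_ge0// gerBl ltW//; case/andP: hmu.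
Qed.

Definition bpoly (n : nat) (x : R) : R := \sum_(k < n) bcoef k * x ^+ k.+1.

Definition dbpoly (n : nat) (x : R) : R := \sum_(k < n) bcoef k * (k.+1%:R * x ^+ k).

Lemma is_derive_bpoly n (x : R) : is_derive x 1 (bpoly n) (dbpoly n x).
Proof.
elim: n => [|n IH].
  rewrite /dbpoly big_ord0 (_ : bpoly 0 = cst 0); first exact: is_derive_cst.
  by apply/funext => y; rewrite /bpoly big_ord0.
rewrite (_ : bpoly n.+1 = bpoly n + bcoef n \*: (id ^+ n.+1)); last first.
  by apply/funext => y; rewrite /bpoly big_ord_recr /= fctE /= exprfctE.
rewrite /dbpoly big_ord_recr /=; apply: is_deriveD.
by apply: is_derive_eq; rewrite /GRing.scale/= mulr1.
Qed.

(** The function [P = (1 - x)^mu] solves [(1 - x) P' + mu P = 0]; the truncation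
    [1 - bpoly n] solves it up to a single monomial. *)
Lemma bpoly_ode n x :
  (1 - x) * dbpoly n x = mu * (1 - bpoly n x) - n.+1%:R * bcoef n * x ^+ n.
Proof.
elim: n => [|n IH]; first by rewrite /dbpoly /bpoly !big_ord0 expr0 /bcoef mulr1n; ring.
have -> : dbpoly n.+1 x = dbpoly n x + bcoef n * (n.+1%:R * x ^+ n).
  by rewrite /dbpoly big_ord_recr.
have -> : bpoly n.+1 x = bpoly n x + bcoef n * x ^+ n.+1.
  by rewrite /bpoly big_ord_recr.
have E : n.+2%:R * bcoef n.+1 = (n.+1%:R - mu) * bcoef n.
  by rewrite /= mulrA mulrCA divff ?mulr1 ?pnatr_eq0.
by rewrite E mulrDr IH exprS; ring.
Qed.

Let gt0_powRD (x r s : R) : 0 < x -> x `^ (r + s) = x `^ r * x `^ s.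
Proof. by move=> x0; rewrite powRD// lt0r_neq0// implybT. Qed.

(** Divide the truncation by the exact solution: [q] equals 1 at 0 and, by
    [bpoly_ode], has a nonnegative derivative. The mean value theorem
    therefore bounds [q x - 1] from both sides. *)
Lemma bpoly_remainder n (x : R) : 0 <= x < 1 ->
  0 <= 1 - bpoly n x - (1 - x) `^ mu <= x ^+ n / (1 - x).
Proof.
move=> /andP[x0 x1]; have /andP[mu0 mu1] := hmu.
have sub_gt0 (y : R) : y \in `[0, x] -> 0 < 1 - y.
  by rewrite in_itv /= subr_gt0 => /andP[_ yx]; exact: le_lt_trans x1.
pose q (y : R) : R := (1 - bpoly n y) * (1 - y) `^ (- mu).
pose dq (y : R) : R := n.+1%:R * bcoef n * y ^+ n * (1 - y) `^ (- mu - 1).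
have qd (y : R) : y \in `[0, x] -> is_derive y 1 q (dq y).
  move=> yx; have y1 := sub_gt0 _ yx.
  have d1 := is_derive_bpoly n y.
  have d3 := @is_derive1_powR R (- mu) (1 - y) y1.
  have d4 : is_derive y 1 (cst 1 - id : R -> R) (- 1).
    by apply: is_derive_eq; rewrite add0r.
  have d2 := @is_derive1_comp R (fun z : R => z `^ (- mu)) (cst 1 - id) y _ _ d3 d4.
  rewrite (_ : q = (cst 1 - bpoly n) * ((fun z : R => z `^ (- mu)) \o (cst 1 - id)))//.
  apply: is_derive_eq; rewrite /GRing.scale /= /dq.
  rewrite (_ : (cst 1 - bpoly n) y = 1 - bpoly n y)//.
  have -> : (1 - y) `^ (- mu) = (1 - y) * (1 - y) `^ (- mu - 1).
    rewrite gt0_powRD// powR_inv1 ?ltW//.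
    by rewrite mulrCA divff ?mulr1// gt_eqF.
  have := bpoly_ode n y.
  move: ((1 - y) `^ (- mu - 1)) (dbpoly n y) (bpoly n y)
    (n.+1%:R * bcoef n * y ^+ n) => a b c d E.
  have -> : d = mu * (1 - c) - (1 - y) * b by rewrite E; ring.
  by ring.
have [|c cx] := @MVT_segment R q dq 0 x x0 (fun y yx => qd y (subset_itv_oo_cc yx)).
  apply: derivable_within_continuous => y yx; by have ? := qd y yx; exact: ex_derive.
have c1 := sub_gt0 _ cx.
have x1' : 0 < 1 - x by rewrite subr_gt0.
have q0 : q 0 = 1.
  rewrite /q subr0 powR1 mulr1 /bpoly big1 ?subr0// => k _.
  by rewrite expr0n /= mulr0.
rewrite q0 subr0 => /(congr1 (fun z => (z + 1) * (1 - x) `^ mu)).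
rewrite subrK /q -mulrA -gt0_powRD// addNr powRr0 mulr1 => ->.
rewrite mulrDl mul1r addrK.
have /andP[c0 cx'] : 0 <= c <= x by move: cx; rewrite in_itv.
have dq0 : 0 <= dq c.
  by rewrite /dq !mulr_ge0 ?powR_ge0 ?exprn_ge0 ?bcoef_ge0.
apply/andP; split; first by apply: mulr_ge0; [exact: mulr_ge0|exact: powR_ge0].
(* Each factor of [dq c] is at most its value at [x], and the constant at most [mu <= 1]. *)
have dqx : dq c * x <= x ^+ n * (1 - x) `^ (- mu - 1).
  rewrite -[leRHS]mulr1; apply: ler_pM => //; last exact: ltW.
  rewrite /dq; apply: ler_pM; rewrite ?powR_ge0 ?mulr_ge0 ?exprn_ge0 ?bcoef_ge0//.
    rewrite -[leRHS]mul1r; apply: ler_pM; rewrite ?mulr_ge0 ?exprn_ge0 ?bcoef_ge0//.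
      exact: le_trans (mul_bcoef_le n) mu1.
    by rewrite lerXn2r.
  rewrite -opprD !powRN lef_pV2 ?posrE ?powR_gt0//.
  by rewrite ge0_ler_powR ?nnegrE ?lerD2l ?lerN2// ltW// addr_gt0.
apply: (le_trans (ler_wpM2r (powR_ge0 _ _) dqx)).
rewrite -mulrA -gt0_powRD//.
by rewrite addrAC addNr add0r powR_inv1// ltW.
Qed.

Lemma bpoly_le1 n (x : R) : 0 <= x < 1 -> bpoly n x <= 1.
Proof.
move=> /(bpoly_remainder n)/andP[+ _].
by have := powR_ge0 (1 - x) mu; lra.
Qed.

Lemma cvg_bpoly (x : R) : 0 <= x < 1 ->
  bpoly n x @[n --> \oo] --> 1 - (1 - x) `^ mu.
Proof.
move=> x01; have /andP[x0 x1] := x01.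
have c0 : x ^+ n / (1 - x) @[n --> \oo] --> (0 : R).
  rewrite -(mul0r (1 - x)^-1); apply: cvgMl.
  by apply: cvg_expr; rewrite ger0_norm.
have cr : 1 - bpoly n x - (1 - x) `^ mu @[n --> \oo] --> (0 : R).
  apply: (@squeeze_cvgr _ _ _ _ (fun=> 0) (fun n => x ^+ n / (1 - x))) => //.
    by apply: nearW => n; exact: bpoly_remainder.
  exact: cvg_cst.
have -> : (bpoly^~ x) = (fun n => 1 - (1 - x) `^ mu - (1 - bpoly n x - (1 - x) `^ mu)).
  by apply/funext => n; ring.
rewrite -[X in _ --> X]subr0; apply: cvgB => //; exact: cvg_cst.
Qed.

End binomial_series.

(** * A weight with explicit nonnegative transform *)

Section exponential_weight_line.
Context {R : realType}.
Local Notation leb := (@lebesgue_measure R).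
Variable e : R.
Hypothesis e0 : 0 < e.

Definition expw (s : R) : R := expR (- (e * `|s|)).

Lemma expw_ge0 s : 0 <= expw s. Proof. exact: expR_ge0. Qed.

Lemma continuous_expw : continuous expw.
Proof.
move=> s; apply: continuous_comp; last exact: continuous_expR.
apply: cvgN; apply: cvgMr; exact: norm_continuous.
Qed.

(** Adding 1 to the cosine makes the integrand nonnegative, as the fundamental
    theorem of calculus on a half-line requires; the constant is subtracted
    again in [integral_expw_cos]. *)
Lemma integral0y_expR_cos (a : R) :
  (\int[leb]_(s in `[(0 : R)%R, +oo[) (expR (- (e * s)) * (1 + cos (a * s)))%:E =
   (e^-1 + e / (e ^+ 2 + a ^+ 2))%:E)%E.
Proof.
pose D := e ^+ 2 + a ^+ 2.
have D0 : 0 < D by rewrite ltr_pwDl ?exprn_gt0 ?sqr_ge0.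
pose F (s : R) := expR (- (e * s)) * ((a * sin (a * s) - e * cos (a * s)) / D - e^-1).
have dF (s : R) : is_derive s 1 F (expR (- (e * s)) * (1 + cos (a * s))).
  have dl (b : R) : is_derive s 1 (b \*: id : R -> R) b.
    by apply: is_derive_eq; rewrite /GRing.scale /= mulr1.
  have d1 := @is_derive1_comp R expR ((- e) \*: id) s _ _ (is_derive_expR _) (dl _).
  have d2 := @is_derive1_comp R sin (a \*: id) s _ _ (is_derive_sin _) (dl _).
  have d3 := @is_derive1_comp R cos (a \*: id) s _ _ (is_derive_cos _) (dl _).
  have -> : F = (expR \o ((- e) \*: id)) *
      (D^-1 \*: (a \*: (sin \o (a \*: id)) - e \*: (cos \o (a \*: id))) - cst e^-1).
    apply/funext => y; rewrite /F !fctE /= /GRing.scale /= mulNr.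
    by rewrite (mulrC _ D^-1).
  apply: is_derive_eq.
  rewrite !fctE /= /GRing.scale /= mulNr /D.
  by field; rewrite !gt_eqF.
have F0 : F 0 = - (e^-1 + e / D).
  by rewrite /F !mulr0 oppr0 expR0 sin0 cos0 mulr0 sub0r mulr1 mul1r mulNr opprD addrC.
rewrite (@ge0_continuous_FTC2y R _ F 0 0).
- by rewrite F0 -EFinB sub0r opprK.
- by move=> s _; rewrite mulr_ge0 ?expR_ge0// -lerBlDl sub0r cos_geN1.
- apply: continuous_subspaceT => s.
  apply: cvgM; first apply: continuous_comp.
    + by apply: cvgN; exact: mulrl_continuous.
    + exact: continuous_expR.
  apply: cvgD; first exact: cvg_cst.
  by apply: continuous_comp; [exact: mulrl_continuous|exact: continuous_cos].
- pose M := (`|a| + e) / D + e^-1.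
  have Fb (s : R) : `|F s| <= expR (- (e * s)) * M.
    rewrite /F normrM (ger0_norm (expR_ge0 _)) ler_wpM2l ?expR_ge0//.
    have e0' : 0 <= e^-1 by rewrite invr_ge0 ltW.
    have D0' : 0 <= D^-1 by rewrite invr_ge0 ltW.
    apply: (le_trans (ler_normB _ _)); rewrite (ger0_norm e0') lerD2r.
    rewrite normrM (ger0_norm D0') ler_wpM2r//.
    apply: (le_trans (ler_normB _ _)); rewrite !normrM lerD//.
      by rewrite -[leRHS]mulr1 ler_wpM2l// sin_max.
    by rewrite (gtr0_norm e0) -[leRHS]mulr1 ler_pM2l// cos_max.
  apply/norm_cvg0P.
  apply: (@squeeze_cvgr _ _ _ _ (fun=> 0) (fun s => expR (- (e * s)) * M)).
  + by apply: nearW => s; rewrite normr_ge0 Fb.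
  + exact: cvg_cst.
  + rewrite -(mul0r M); apply: cvgMl.
    rewrite (_ : (fun s => _) = (fun z => expR (- z)) \o (fun z => e * z))//.
    apply: (@cvg_comp _ _ _ _ _ _ (pinfty_nbhs R)); last exact: cvgr_expR.
    exact: gt0_cvgMry.
- by move=> s _; have ? := dF s; exact: ex_derive.
- apply: cvg_at_right_filter.
  have ? := dF 0; apply: differentiable_continuous; apply/derivable1_diffP; exact: ex_derive.
- by move=> s _; have ? := dF s; rewrite derive1E derive_val.
Qed.

Lemma integral_expw_1Dcos (a : R) :
  (\int[leb]_s (expw s * (1 + cos (a * s)))%:E =
   (2 * (e^-1 + e / (e ^+ 2 + a ^+ 2)))%:E)%E.
Proof.
rewrite (@ge0_symfun_integralT R (fun s => expw s * (1 + cos (a * s)))).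
- rewrite EFinM; congr (_ * _)%E; rewrite -integral0y_expR_cos -set_itvcy.
  apply: eq_integral => s; rewrite inE /= in_itv /= andbT => s0.
  by rewrite /expw ger0_norm.
- by move=> s; rewrite mulr_ge0 ?expw_ge0// -lerBlDl sub0r cos_geN1.
- move=> s; apply: cvgM; first exact: continuous_expw.
  apply: cvgD; first exact: cvg_cst.
  by apply: continuous_comp; [exact: mulrl_continuous|exact: continuous_cos].
- by move=> s /=; rewrite /expw normrN mulrN cosN.
Qed.

Lemma integrable_expw : leb.-integrable setT (EFin \o expw).
Proof.
have mw : measurable_fun setT expw by exact: continuous_measurable_fun continuous_expw.
apply/integrableP; split; first exact/measurable_EFinP.
apply: (@le_lt_trans _ _ (\int[leb]_s (expw s * (1 + cos (0 * s)))%:E)%E).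
  apply: ge0_le_integral => //.
  - by apply: measurableT_comp => //; exact/measurable_EFinP.
  - apply/measurable_EFinP; apply: measurable_funM => //.
    by under eq_fun do rewrite mul0r cos0; exact: measurable_cst.
  - move=> s _ /=; rewrite lee_fin ger0_norm ?expw_ge0// mul0r cos0.
    by rewrite ler_peMr ?expw_ge0// lerDl.
by rewrite integral_expw_1Dcos ltry.
Qed.

Lemma integrable_expw_mul (h : R -> R) : continuous h -> (forall s, `|h s| <= 1) ->
  leb.-integrable setT (EFin \o (fun s => expw s * h s)).
Proof.
move=> ch h1; under eq_fun do rewrite mulrC.
apply: integrable_bounded_mul; [exact: continuous_measurable_fun|by exists 1|].
exact: integrable_expw.
Qed.

Lemma integral_expw_sin (a : R) :
  (\int[leb]_s (expw s * sin (a * s))%:E = 0)%E.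
Proof.
set f := fun s => (expw s * sin (a * s))%:E.
have ci : leb.-integrable setT f.
  apply: (@integrable_expw_mul (fun s => sin (a * s))) => [s|s]; last exact: sin_max.
  by apply: continuous_comp; [exact: mulrl_continuous|exact: continuous_sin].
have fN s : (f (- s)%R = - f s)%E.
  by rewrite /f /expw normrN mulrN sinN mulrN EFinN.
have : (\int[leb]_s f s = \int[leb]_s f (- s)%R)%E.
  transitivity (\int[pushforward leb (-%R : measurableTypeR R -> measurableTypeR R)]_s f s)%E.
    by apply: eq_measure_integral => //= A mA _; exact/esym/lebesgue_measureN.
  apply: (@integral_pushforward _ _ _ _ _
    (-%R : measurableTypeR R -> measurableTypeR R) _ leb setT f) => //.
    exact: measurable_int ci.
  rewrite preimage_setT; have := integrableN ci.
  apply: eq_integrable => //.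
  by move=> s _; rewrite /= fN.
under [RHS]eq_integral do rewrite fN.
rewrite integralN; last exact: integrable_add_def.
have := integrable_fin_num measurableT ci.
move: (integral _ _ _) => [r| |]//= _ [rN]; congr EFin; lra.
Qed.

(** The phase [th] packages the cosine integral (nonnegative) and the sine
    integral (zero, by oddness) in one formula, which is what makes the
    induction on the dimension in [integral_expwN_cos] go through. *)
Lemma integral_expw_cos (a : R) : exists2 C : R, 0 <= C &
  forall th, (\int[leb]_s (expw s * cos (a * s + th))%:E = (C * cos th)%:E)%E.
Proof.
have ccos : continuous (fun s : R => cos (a * s)).
  by move=> s; apply: continuous_comp; [exact: mulrl_continuous|exact: continuous_cos].
have csin : continuous (fun s : R => sin (a * s)).
  by move=> s; apply: continuous_comp; [exact: mulrl_continuous|exact: continuous_sin].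
have ic := integrable_expw_mul ccos (fun s => cos_max (a * s)).
have isn := integrable_expw_mul csin (fun s => sin_max (a * s)).
have I0 : (\int[leb]_s (expw s)%:E = (2 * e^-1)%:E)%E.
  have := integral_expw_1Dcos 0.
  under eq_integral do rewrite mul0r cos0 mulrC EFinM.
  rewrite integralZl//; last exact: integrable_expw.
  have := integrable_fin_num measurableT integrable_expw.
  move: (integral _ _ _) => [r| |]//= _.
  rewrite -EFinM => -[rE]; congr EFin.
  have eE : e / (e ^+ 2 + 0 ^+ 2) = e^-1 by rewrite expr0n /= addr0; field; rewrite gt_eqF.
  by move: rE; rewrite eE; lra.
have Ic : (\int[leb]_s (expw s * cos (a * s))%:E = (2 * (e / (e ^+ 2 + a ^+ 2)))%:E)%E.
  have := integral_expw_1Dcos a.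
  under eq_integral do rewrite mulrDr mulr1 EFinD.
  rewrite integralD//; last exact: integrable_expw.
  rewrite I0; have := integrable_fin_num measurableT ic.
  move: (integral _ _ _) => [r| |]//= _.
  by rewrite -EFinD => -[]; rewrite mulrDr => /addrI ->.
exists (2 * (e / (e ^+ 2 + a ^+ 2))).
  by rewrite mulr_ge0// divr_ge0// ?addr_ge0 ?sqr_ge0 ?exprn_ge0// ltW.
move=> th.
have -> : (\int[leb]_s (expw s * cos (a * s + th))%:E =
  \int[leb]_s ((cos th)%:E * (expw s * cos (a * s))%:E -
               (sin th)%:E * (expw s * sin (a * s))%:E))%E.
  by apply: eq_integral => s _; rewrite -!EFinM -EFinB cosD; congr EFin; ring.
rewrite integralB//; [|exact: integrableZl..].
rewrite !integralZl// Ic integral_expw_sin mule0 sube0 -EFinM.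
by rewrite mulrC.
Qed.

End exponential_weight_line.

Section exponential_weight.
Context {R : realType}.
Local Notation leb := (@lebesgue_measure R).
Variable e : R.
Hypothesis e0 : 0 < e.

Definition expwN (N : nat) (xi : euclid R N) : R := \prod_(i < N) expw e (tnth xi i).

Lemma expwN_ge0 N xi : 0 <= @expwN N xi.
Proof. by apply: prodr_ge0 => i _; exact: expw_ge0. Qed.

Lemma measurable_expwN N : measurable_fun setT (@expwN N).
Proof.
apply: measurable_prod => i _.
apply: (@measurableT_comp _ _ _ _ _ _ (expw e)); last exact: measurable_tnth.
by apply: continuous_measurable_fun => s; exact: continuous_expw.
Qed.

Lemma expwN_cons N (s : R) (xi : euclid R N) :
  expwN (econs (s, xi)) = expw e s * expwN xi.
Proof.
rewrite /expwN big_ord_recl; congr (_ * _).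
by apply: eq_bigr => i _; rewrite tnthS.
Qed.

Lemma dotp_cons N (x : euclid R N.+1) (s : R) (xi : euclid R N) :
  dotp x (econs (s, xi)) = thead x * s + dotp [tuple of behead x] xi.
Proof.
rewrite /dotp big_ord_recl; congr (_ + _).
by apply: eq_bigr => i _; rewrite tnthS tnth_behead; congr (tnth x _ * _);
  apply/val_inj; rewrite /= inordK// ltnS.
Qed.

Local Notation prodm N := (@lebesgue_measure R \x @lebesgueN R N)%E.

Lemma integrable_lebesgueNS N (f : euclid R N.+1 -> \bar R) : measurable_fun setT f ->
  (prodm N).-integrable setT (f \o @econs R N) ->
  (@lebesgueN R N.+1).-integrable setT f.
Proof.
move=> mf fi.
apply: (@integrable_pushforward _ _ _ _ _ _ (@measurable_econs R N) (prodm N) setT f) => //.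
Qed.

Lemma integral_lebesgueNS N (f : euclid R N.+1 -> \bar R) : measurable_fun setT f ->
  (prodm N).-integrable setT (f \o @econs R N) ->
  (\int[lebesgueN]_xi f xi = \int[leb]_s \int[lebesgueN]_xi f (econs (s, xi)))%E.
Proof.
move=> mf fi.
transitivity (\int[prodm N]_z (f \o @econs R N) z)%E.
  by apply: (@integral_pushforward _ _ _ _ _ _ (@measurable_econs R N) (prodm N) setT f).
by rewrite -integral12_prod_meas1.
Qed.

Lemma integrable_econs_expwN N : (@lebesgueN R N).-integrable setT (EFin \o @expwN N) ->
  (prodm N).-integrable setT ((EFin \o @expwN N.+1) \o @econs R N).
Proof.
move=> iN; apply/integrable12ltyP.
  apply: measurableT_comp; last exact: measurable_econs.
  by apply/measurable_EFinP; exact: measurable_expwN.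
have E (s : R) : (\int[@lebesgueN R N]_xi `|((EFin \o @expwN N.+1) \o @econs R N) (s, xi)| =
    (expw e s)%:E * \int[@lebesgueN R N]_xi (expwN xi)%:E)%E.
  rewrite -integralZl//; apply: eq_integral => xi _ /=.
  by rewrite expwN_cons ger0_norm ?EFinM// mulr_ge0 ?expw_ge0 ?expwN_ge0.
under eq_integral do rewrite E.
have /fineK <- := integrable_fin_num measurableT iN.
rewrite integralZr//; last exact: integrable_expw.
by rewrite ltey_eq fin_numM//; exact: (integrable_fin_num measurableT (integrable_expw e0)).
Qed.

Lemma integrable_expwN N : (@lebesgueN R N).-integrable setT (EFin \o @expwN N).
Proof.
elim: N => [|N IH]; last first.
  apply: integrable_lebesgueNS; last exact: integrable_econs_expwN.
  by apply/measurable_EFinP; exact: measurable_expwN.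
have mE : measurable_fun setT (EFin \o @expwN 0).
  by apply/measurable_EFinP; exact: measurable_expwN.
apply/integrableP; split => //.
rewrite [X in (X < _)%E](@integral_dirac _ _ ([tuple] : euclid R 0) R setT measurableT)//.
- by rewrite diracT mul1e ltry.
- exact: measurableT_comp.
Qed.

(** Fubini splits off the first coordinate, which enters the integral over the
    remaining ones as a phase; the constant is the product of the
    one-dimensional transforms. *)
Lemma integral_expwN_cos N (x : euclid R N) : exists2 C : R, 0 <= C &
  forall th, (\int[lebesgueN]_xi (expwN xi * cos (dotp x xi + th))%:E = (C * cos th)%:E)%E.
Proof.
have mf M (y : euclid R M) th : measurable_fun setT
    (fun xi : euclid R M => cos (dotp y xi + th)).
  apply: measurableT_comp; first by apply: continuous_measurable_fun; exact: continuous_cos.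
  by apply: measurable_funD => //; exact: measurable_dotp.
elim: N => [|N IH] in x *.
  exists 1 => // th.
  rewrite [LHS](@integral_dirac _ _ ([tuple] : euclid R 0) R setT measurableT)//.
    by rewrite diracT mul1e /expwN /dotp !big_ord0 add0r.
  apply/measurable_EFinP; apply: measurable_funM; first exact: measurable_expwN.
  exact: mf.
have [C C0 CE] := integral_expw_cos e0 (thead x).
have [C' C0' CE'] := IH [tuple of behead x].
exists (C * C'); first exact: mulr_ge0.
move=> th; rewrite integral_lebesgueNS; last 2 first.
- by apply/measurable_EFinP; apply: measurable_funM; [exact: measurable_expwN|exact: mf].
- rewrite (_ : _ \o _ = EFin \o (fun z => cos (dotp x (econs z) + th) * expwN (econs z))).
    apply: integrable_bounded_mul; last exact/integrable_econs_expwN/integrable_expwN.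
      exact: measurableT_comp (mf _ x th) (@measurable_econs R N).
    by exists 1 => z; exact: cos_max.
  by apply/funext => z /=; rewrite mulrC.
transitivity (\int[leb]_s (C'%:E * (expw e s * cos (thead x * s + th))%:E))%E.
  apply: eq_integral => s _.
  under eq_integral do rewrite expwN_cons dotp_cons -mulrA EFinM addrAC [_ + dotp _ _]addrC.
  rewrite integralZl//; last first.
    rewrite (_ : (fun xi => _) = EFin \o
        (fun xi => cos (dotp [tuple of behead x] xi + (thead x * s + th)) * expwN xi)).
      apply: integrable_bounded_mul; last exact: integrable_expwN.
        exact: mf.
      by exists 1 => xi; exact: cos_max.
    by apply/funext => xi /=; rewrite mulrC addrCA addrA addrAC.
  by rewrite CE' -!EFinM; congr EFin; ring.
rewrite integralZl//; last first.
  apply: (integrable_expw_mul e0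
    (h := fun s => cos (thead x * s + th))) => [s|s]; last exact: cos_max.
  apply: continuous_comp; last exact: continuous_cos.
  by apply: cvgD; [exact: mulrl_continuous|exact: cvg_cst].
by rewrite CE -EFinM; congr EFin; ring.
Qed.

End exponential_weight.

(** * The symbol exp (- t |xi|^(2 mu)) is a multiplier *)

Section fractional_symbol.
Context {R : realType}.

Lemma pos_multiplier_bpoly N (mu : R) (f : euclid R N -> R) n : 0 < mu <= 1 ->
  pos_multiplier f -> pos_multiplier (fun xi => bpoly mu n (f xi)).
Proof.
move=> hmu pf; apply: pos_multiplier_sum => k.
apply: pos_multiplierM; last exact: pos_multiplierX.
exact/pos_multiplier_cst/bcoef_ge0.
Qed.

(** Since the binomial series of [1 - (1 - x)^mu] has nonnegative coefficients,
    [exp (- T (1 - f)^mu)] is the limit of the multipliers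
    [exp (- T) exp (T bpoly mu n f)], all bounded by 1. *)
Lemma pos_multiplier_expR_powR N (mu T : R) (f : euclid R N -> R) :
  0 < mu <= 1 -> 0 <= T -> pos_multiplier f -> (forall xi, 0 <= f xi < 1) ->
  pos_multiplier (fun xi => expR (- (T * (1 - f xi) `^ mu))).
Proof.
move=> hmu T0 pf f01.
apply: (@pos_multiplier_lim _ _ (fun n xi => expR (- T) * expR (T * bpoly mu n (f xi))) _ 1).
- move=> n; apply: pos_multiplierM; first exact/pos_multiplier_cst/expR_ge0.
  apply/pos_multiplier_expR/pos_multiplierM; first exact: pos_multiplier_cst.
  exact: pos_multiplier_bpoly.
- move=> n xi; rewrite -expRD ger0_norm ?expR_ge0// -expR0 ler_expR.
  have /(ler_wpM2l T0) := bpoly_le1 hmu n (f01 xi).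
  by rewrite mulr1; lra.
- move=> xi; have -> : - (T * (1 - f xi) `^ mu) = - T + T * (1 - (1 - f xi) `^ mu) by ring.
  rewrite expRD; apply: cvgMr.
  apply: (@continuous_cvg _ _ _ _ _ (fun n => T * bpoly mu n (f xi)) expR).
    exact: continuous_expR.
  by apply: cvgMr; exact: cvg_bpoly.
Qed.

(** The difference quotients at 0 of [h |-> sin (y h)] along [h = 1 / (n + 1)]. *)
Lemma cvg_scaled_sin (y : R) : n.+1%:R * sin (y / n.+1%:R) @[n --> \oo] --> y.
Proof.
have dl : is_derive (0 : R) 1 (y \*: id : R -> R) y.
  by apply: is_derive_eq; rewrite /GRing.scale /= mulr1.
have ds := @is_derive1_comp R sin (y \*: id) 0 _ _ (is_derive_sin _) dl.
have cl : h^-1 *: ((sin \o (y \*: id)) (h *: 1 + 0) - (sin \o (y \*: id)) 0)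
    @[h --> (0 : R)^'] --> 'D_1 (sin \o (y \*: id)) (0 : R).
  exact: ex_derive.
move: cl; rewrite derive_val /= [y *: 0]mulr0 cos0 mul1r sin0 => cl.
move/cvgr_dnbhsP : cl => /(_ (@harmonic R)).
have -> : (fun n => n.+1%:R * sin (y / n.+1%:R)) = (fun n => (harmonic n)^-1 *:
    (sin ((y \*: id) (harmonic n *: 1 + 0)) - 0)) :> (nat -> R).
  by apply/funext => n; rewrite /harmonic/= /GRing.scale /= invrK addr0 subr0 mulr1.
by apply; split; [move=> n; rewrite gt_eqF//= invr_gt0|exact: cvg_harmonic].
Qed.

(** At [l = 0] the power is only right-continuous, hence the positivity of the
    sequence. *)
Lemma cvg_powR (mu : R) (u : nat -> R) (l : R) : 0 < mu -> (forall n, 0 < u n) ->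
  u n @[n --> \oo] --> l -> u n `^ mu @[n --> \oo] --> l `^ mu.
Proof.
move=> mu0 u0 ul.
have l0 : 0 <= l.
  rewrite -(cvg_lim _ ul)//; apply: limr_ge.
    by apply/cvg_ex; exists l.
  by apply: nearW => n; exact: ltW.
have [l0'|] := eqVneq l 0; last first.
  move=> l1; have {l0 l1}l0 : 0 < l by rewrite lt_def l1.
  apply: (@continuous_cvg _ _ _ _ _ u (fun z => z `^ mu)) => //.
  have ? := @is_derive1_powR R mu l l0.
  by apply: differentiable_continuous; apply/derivable1_diffP; exact: ex_derive.
rewrite l0' powR0 ?gt_eqF//.
have /cvg_at_rightP := powR_cvg0 mu0.
by apply; split => //; rewrite -l0'.
Qed.

(** [psi n] approximates [|xi|^2] by the [N m^2 (1 - f)] of a multiplier [f] with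
    values in [0, 1), so that [pos_multiplier_expR_powR] applies before the limit. *)
Lemma pos_multiplier_frac_symbol N (mu t : R) : (1 <= N)%N -> 0 < mu <= 1 -> 0 < t ->
  pos_multiplier (fun xi : euclid R N => expR (- (t * enorm xi `^ (2 * mu)))).
Proof.
move=> N1 hmu t0; have /andP[mu0 mu1] := hmu.
have N0 : 0 < N%:R :> R by rewrite ltr0n.
pose m (n : nat) : R := n.+1%:R.
have m0 n : 0 < m n by rewrite ltr0n.
have m1 n : 1 <= m n by rewrite ler1n.
(* [r < 1] keeps [f] away from 1, where the binomial series is not controlled;
   the cube makes [1 - r] negligible after multiplication by [m ^+ 2]. *)
pose r n := 1 - (m n ^+ 3)^-1.
have r01 n : 0 <= r n < 1.
  rewrite /r subr_ge0 gtrBl invr_gt0 exprn_gt0// andbT.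
  by rewrite invf_le1 ?exprn_gt0// exprn_ege1.
pose f n (xi : euclid R N) := r n / N%:R * \sum_(i < N) cos (tnth xi i / m n) ^+ 2.
have cos2_le1 (y : R) : cos y ^+ 2 <= 1 by rewrite cos2sin2 gerBl sqr_ge0.
have f01 n xi : 0 <= f n xi < 1.
  have /andP[r0 r1] := r01 n.
  rewrite /f mulr_ge0 ?divr_ge0 ?sumr_ge0//=; last by move=> i _; exact: sqr_ge0.
  apply: le_lt_trans r1; rewrite -mulrA ler_piMr// ler_pdivrMl// mulr1.
  rewrite (le_trans (ler_sum _ (fun i _ => cos2_le1 _)))//.
  by rewrite sumr_const card_ord.
have pf n : pos_multiplier (f n).
  have /andP[r0 r1] := r01 n.
  apply: pos_multiplierM; first by apply: pos_multiplier_cst; rewrite divr_ge0.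
  apply: pos_multiplier_sum => i; apply: pos_multiplierX.
  under eq_fun do rewrite mulrC -dotp_coord.
  exact: pos_multiplier_cos.
pose psi n xi := N%:R * m n ^+ 2 * (1 - f n xi).
apply: (@pos_multiplier_lim _ _ (fun n xi => expR (- (t * psi n xi `^ mu))) _ 1).
- move=> n; have Nm0 : 0 <= N%:R * m n ^+ 2 by rewrite mulr_ge0 ?exprn_ge0// ltW.
  rewrite (_ : (fun xi => _) =
      (fun xi => expR (- (t * (N%:R * m n ^+ 2) `^ mu * (1 - f n xi) `^ mu)))).
    apply: pos_multiplier_expR_powR => //.
    by rewrite mulr_ge0 ?powR_ge0 ?ltW.
  apply/funext => xi; rewrite /psi powRM//; first by rewrite !mulrA.
  by rewrite subr_ge0 ltW//; case/andP: (f01 n xi).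
- move=> n xi; rewrite ger0_norm ?expR_ge0// -expR0 ler_expR.
  by rewrite oppr_le0 mulr_ge0 ?powR_ge0 ?ltW.
move=> xi; apply: (@continuous_cvg _ _ _ _ _ (fun n => - (t * psi n xi `^ mu)) expR).
  exact: continuous_expR.
apply: cvgN; apply: cvgMr; rewrite powRrM.
have d0 : 0 <= dotp xi xi by apply: sumr_ge0 => i _; rewrite -expr2 sqr_ge0.
rewrite {1}/enorm powR_mulrn ?sqrtr_ge0// sqr_sqrtr//.
apply: cvg_powR => //.
  by move=> n; rewrite !mulr_gt0 ?exprn_gt0 ?subr_gt0//; have /andP[] := f01 n xi.
(* The sine formula turns [m ^+ 2 * (1 - cos ^+ 2)] into a square that converges. *)
have psiE n : psi n xi = N%:R * (m n)^-1 +
    r n * \sum_(i < N) (m n * sin (tnth xi i / m n)) ^+ 2.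
  have -> : \sum_(i < N) (m n * sin (tnth xi i / m n)) ^+ 2 =
      m n ^+ 2 * (N%:R - \sum_(i < N) cos (tnth xi i / m n) ^+ 2).
    rewrite -[N in N%:R]card_ord -sumr_const -sumrB mulr_sumr.
    by apply: eq_bigr => i _; rewrite exprMn sin2cos2.
  by rewrite /psi /f /r; field; rewrite !gt_eqF.
rewrite (funext psiE).
have cm : (m n)^-1 @[n --> \oo] --> (0 : R) by exact: cvg_harmonic.
rewrite -[X in _ --> X]add0r; apply: cvgD.
  by rewrite -(mulr0 N%:R); apply: cvgMr.
rewrite -[X in _ --> X]mul1r; apply: cvgM.
  rewrite -[X in _ --> X]subr0; apply: cvgB; first exact: cvg_cst.
  have -> : 0 = 0 ^+ 3 :> R by rewrite expr0n.
  rewrite (_ : (fun n => m n ^- 3) = (fun n => (m n)^-1 ^+ 3)); last first.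
    by apply/funext => n; rewrite exprVn.
  apply: (@continuous_cvg _ _ _ _ _ (fun n => (m n)^-1) (fun z : R => z ^+ 3)) => //.
  exact: exprn_continuous.
apply: cvg_big => [|i _]; first exact: add_continuous.
rewrite -expr2; apply: (@continuous_cvg _ _ _ _ _
  (fun n => m n * sin (tnth xi i / m n)) (fun z : R => z ^+ 2)).
  exact: exprn_continuous.
exact: cvg_scaled_sin.
Qed.

End fractional_symbol.

(** * Nonnegativity of the kernel *)

Section kernel.
Context {R : realType}.

Lemma fourier_ge0_expwN N (e : R) : 0 < e -> fourier_ge0 (@expwN R e N).
Proof.
move=> e0 x; have [C C0 CE] := integral_expwN_cos e0 x.
have := CE 0; under eq_integral do rewrite addr0.
by move=> ->; rewrite cos0 mulr1 lee_fin.
Qed.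

Lemma expwN_le1 N (e : R) (xi : euclid R N) : 0 < e -> expwN e xi <= 1.
Proof.
move=> e0; apply: prodr_ile1 => i _; rewrite expw_ge0 /= /expw -expR0 ler_expR oppr_le0.
by rewrite mulr_ge0// ltW.
Qed.

Lemma cvg_expwN N (xi : euclid R N) : expwN (harmonic n) xi @[n --> \oo] --> (1 : R).
Proof.
have -> : 1 = \prod_(i < N) (1 : R) by rewrite big1.
apply: cvg_big => [|i _]; first exact: mul_continuous.
rewrite /expw -expR0.
apply: (@continuous_cvg _ _ _ _ _ (fun n => - (harmonic n * `|tnth xi i|)) expR).
  exact: continuous_expR.
rewrite -oppr0; apply: cvgN; rewrite -(mul0r `|tnth xi i|); apply: cvgMl.
exact: cvg_harmonic.
Qed.

(** Against the weight the integral is nonnegative, and the weight increases to 1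
    as its rate goes to 0. No decay of [f] is assumed: when the integral has no
    finite value, its real value is 0 by convention. *)
Lemma pos_multiplier_Rintegral_ge0 N (f : euclid R N -> R) (x : euclid R N) :
  pos_multiplier f -> 0 <= Rintegral lebesgueN setT (fun xi => f xi * cos (dotp x xi)).
Proof.
move=> [mf [M fM] pf].
have mfc : measurable_fun setT (fun xi => f xi * cos (dotp x xi)).
  by apply: measurable_funM => //; exact: measurable_cos_dotp.
rewrite /Rintegral.
have [|] := boolP
  ((\int[lebesgueN]_xi (f xi * cos (dotp x xi))%:E)%E \is a fin_num); last first.
  by case: (integral _ _ _).
rewrite -integral_fin_num_abs// => fin; apply: fine_ge0.
have [] := @dominated_convergence _ _ R (@lebesgueN R N) setT measurableT
  (fun n xi => (f xi * expwN (harmonic n) xi * cos (dotp x xi))%:E)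
  (fun xi => (f xi * cos (dotp x xi))%:E)
  (fun xi => `|(f xi * cos (dotp x xi))%:E|%E).
- move=> n; apply/measurable_EFinP.
  apply: measurable_funM; last exact: measurable_cos_dotp.
  by apply: measurable_funM => //; exact: measurable_expwN.
- exact/measurable_EFinP.
- apply: aeW => xi _; apply/cvg_EFin; first exact: nearW.
  apply: cvgMl; rewrite -[X in _ --> X]mulr1; apply: cvgMr; exact: cvg_expwN.
- by apply: integrable_abse; apply/integrableP; split => //; exact/measurable_EFinP.
- apply: aeW => xi n _ /=; rewrite lee_fin mulrAC normrM ler_piMr//.
  by rewrite ger0_norm ?expwN_ge0// expwN_le1//= invr_gt0.
move=> _ _ cI.
rewrite -(cvg_lim _ cI)//; apply: lime_ge; first by apply/cvg_ex; eexists; exact: cI.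
apply: nearW => n; apply: pf; first by apply: integrable_expwN; rewrite /= invr_gt0.
by apply: fourier_ge0_expwN; rewrite /= invr_gt0.
Qed.

Lemma frac_heat_kernel_ge0 N (mu t : R) (x : euclid R N) :
  (1 <= N)%N -> 0 < mu <= 1 -> 0 < t -> 0 <= frac_heat_kernel mu t x.
Proof.
move=> N1 hmu t0; rewrite /frac_heat_kernel /= mul0r subr0 mulr_ge0//.
  by rewrite invr_ge0 exprn_ge0// mulr_ge0 ?pi_ge0.
exact/pos_multiplier_Rintegral_ge0/pos_multiplier_frac_symbol.
Qed.

End kernel.

(** * Integrals of nonnegative data *)

Section ae_nonneg.
Import HBNNSimple.

(** As [f] may fail to be measurable, the argument goes back to the definition of
    the integral: a simple function below the negative part of [f] vanishes outside
    a null set. *)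
Lemma ae_ge0_integral_ge0 d (T : measurableType d) (R : realType)
    (mu : {measure set T -> \bar R}) (f : T -> \bar R) :
  {ae mu, forall y, (0 <= f y)%E} -> (0 <= \int[mu]_y f y)%E.
Proof.
move=> [Z [mZ Z0 fZ]].
have fn0 : (\int[mu]_y f^\- y = 0)%E.
  apply/eqP; rewrite eq_le integral_ge0// andbT.
  rewrite ge0_integralTE//; apply: ge_ereal_sup => _ [h hf <-].
  rewrite -integralT_nnsfun (@ge0_negligible_integral _ _ _ _ _ Z)//; last 2 first.
    exact/measurable_EFinP.
    by move=> y _; rewrite lee_fin.
  rewrite integral0_eq// => y [_ Zy].
  have fy : (0 <= f y)%E by apply: contrapT => nfy; apply: Zy; exact: fZ.
  apply/eqP; rewrite eq_le; apply/andP; split; last by rewrite lee_fin.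
  by rewrite (le_trans (hf y))// funenegE ge_max lexx andbT oppe_le0.
by rewrite integralE fn0 sube0 integral_ge0.
Qed.

End ae_nonneg.

(** The negative part lives off [D], where the positive part is null, so the sign
    condition on a ball minus [D] says that the negative part is null there;
    countably many balls cover the space. *)
Lemma radon_ge0_neg0 (R : realType) (N : nat) (nu : radon_measure R N) :
  radon_ge0 nu -> forall A, measurable A -> radon_neg nu A = 0%E.
Proof.
move=> nu0.
have [D [mD pD nD]] := radon_singular nu.
pose o : euclid R N := [tuple 0 | i < N].
have ball0 n : radon_neg nu (eball o n%:R) = 0%E.
  have mb := measurable_eball o n%:R.
  pose B := eball o n%:R `\` D.
  have mB : measurable B by exact: measurableD.
  have /(_ mB) := nu0 B o n%:R; rewrite /radon_val.
  have -> : radon_pos nu B = 0%E.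
    apply/eqP; rewrite eq_le measure_ge0 andbT -pD le_measure ?inE//; last by move=> y [].
    exact: measurableC.
  rewrite sub0e => /(_ (@subDsetl _ _ _)); rewrite oppe_ge0 => B0.
  apply/eqP; rewrite eq_le measure_ge0 andbT.
  have BD0 : (radon_neg nu B + radon_neg nu D <= 0)%E by rewrite nD adde0.
  apply: (le_trans _ BD0); apply: (le_trans _ (measureU2 _ mB mD)).
  rewrite le_measure ?inE//; first exact: measurableU.
  by move=> y yb; have [yD|yD] := pselect (D y); [right|left].
move=> A mA; apply/eqP; rewrite eq_le measure_ge0 andbT.
have bigT : A `<=` \bigcup_n eball o n%:R.
  move=> y _; exists (Num.truncn (enorm (subt y o))).+1 => //=.
  by rewrite /eball /=; exact: truncnS_gt.
apply: (@le_trans _ _ (\sum_(n <oo) radon_neg nu (eball o n%:R))%E); last by rewrite eseries0.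
by apply: measure_sigma_subadditive => // n; exact: measurable_eball.
Qed.

Theorem theorem4p1 (R : realType) (N : nat) (mu : R) (p : \bar R) (l : R)
    (hN : (1 <= N)%N) (hmu : 0 < mu <= 1)
    (hp : (1 <= p)%E) (hl : 0 < l <= N%:R) :
  (forall u0 : euclid R N -> R,
     morrey_space p l u0 ->
     {ae lebesgueN, forall y : euclid R N, 0 <= u0 y} ->
     forall (t : R) (x : euclid R N), 0 < t -> (0 <= frac_heat mu t u0 x)%E) /\
  (forall nu : radon_measure R N,
     morrey_measure l nu ->
     radon_ge0 nu ->
     forall (t : R) (x : euclid R N), 0 < t ->
       (0 <= frac_heat_measure mu t nu x)%E).
Proof.
split=> [u0 _ u0_ge0 t x t0 | nu _ nu_ge0 t x t0].
  apply: ae_ge0_integral_ge0; apply: filterS u0_ge0 => y uy.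
  by rewrite lee_fin mulr_ge0// frac_heat_kernel_ge0.
rewrite /frac_heat_measure.
have -> : (\int[radon_neg nu]_y (frac_heat_kernel mu t (subt x y))%:E = 0)%E.
  rewrite -(integral_measure_zero setT (fun y => (frac_heat_kernel mu t (subt x y))%:E)).
  apply: eq_measure_integral => A mA _.
  by rewrite radon_ge0_neg0.
rewrite sube0; apply: integral_ge0 => y _.
by rewrite lee_fin frac_heat_kernel_ge0.
Qed.
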